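(* Let $G$ be a group, $T$ a type of algebras, and $(\theta,\mathcal A)\in\mathsf{pA}(G,\mathsf{pAl}(T))$. There exists a globalization of $(\theta,\mathcal A)$ in $\mathsf A(G,\mathsf{pAl}(T))$ if and only if the relational system $\mathcal R(\mathcal A)^U$ is functional. In this case $(\theta^U,\mathcal A^U)$ (with the map $a\mapsto[1,a]$) is a universal globalization of $(\theta,\mathcal A)$ in $\mathsf A(G,\mathsf{pAl}(T))$, where $\mathcal A^U$ is the partial algebra structure on $A^U$ such that $\mathcal R(\mathcal A^U)=\mathcal R(\mathcal A)^U$, i.e. $$(f_\gamma)_{\mathcal A^U}([x,a_1],\dots,[x,a_{n_\gamma}])=[x,f_\gamma(a_1,\dots,a_{n_\gamma})].$$ Moreover, $(\theta^U,\mathcal A^U)$ is an $\mathsf A(G,\mathsf{pAl}(T))$-reflector of $(\theta,\mathcal A)$.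
   Context: Partial actions. A partial action of a group $G$ on a set $A$ is a partial map $\theta:G\times A\dashrightarrow A$ such that for all $x,y\in G$, $a\in A$: (i) $\theta(1,a)$ is defined and equals $a$; (ii) if $\theta(x,a)$ is defined, then $\theta(x^{-1},\theta(x,a))$ is defined and equals $a$; (iii) if $\theta(y,a)$ and $\theta(x,\theta(y,a))$ are defined, then $\theta(xy,a)$ is defined and equals $\theta(x,\theta(y,a))$. It is global if everywhere defined. One writes $xa$ for $\theta(x,a)$ and $xa\neq\varnothing$ for ''$xa$ is defined''. A morphism of partial actions $(\theta,A)\to(\theta',A')$ is a map $\varphi:A\to A'$ such that $xa\neq\varnothing$ implies that $x\varphi(a)$ is defined and equals $\varphi(xa)$. Partial algebras. A type of algebras is a sequence $T=\{n_\gamma\}_{\gamma<o(T)}$ of non-negative integers indexed by ordinals. A partial algebra $\mathcal A$ of type $T$ is a set $A$ with partial operations $(f_\gamma)_{\mathcal A}:A^{n_\gamma}\dashrightarrow A$ (if $n_\gamma=0$, $f_\gamma$ is an element of $A$ or undefined). A homomorphism $\varphi:\mathcal A\to\mathcal B$ is a map $A\to B$ such that whenever $f_\gamma(a_1,\dots,a_{n_\gamma})$ is defined, so is $f_\gamma(\varphi(a_1),\dots,\varphi(a_{n_\gamma}))$, and it equals $\varphi(f_\gamma(a_1,\dots,a_{n_\gamma}))$. Let $T+1=\{n_\gamma+1\}_{\gamma<o(T)}$. $\mathcal R(\mathcal A)$ is the relational system on $A$ with the $(n_\gamma+1)$-ary relations $\rho_\gamma=\{(a_1,\dots,a_{n_\gamma},f_\gamma(a_1,\dots,a_{n_\gamma}))\mid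 f_\gamma(a_1,\dots,a_{n_\gamma})\text{ is defined}\}$. A relational system of type $T+1$ with relations $\rho_\gamma$ is functional if for every $\gamma$, $(a_1,\dots,a_{n_\gamma},b),(a_1,\dots,a_{n_\gamma},c)\in\rho_\gamma$ implies $b=c$; functional systems of type $T+1$ correspond exactly to partial algebras of type $T$. A partial action of $G$ on $\mathcal A$ is a partial action of $G$ on the set $A$ such that whenever $f_\gamma(a_1,\dots,a_{n_\gamma})$, $xa_1,\dots,xa_{n_\gamma}$ and $xf_\gamma(a_1,\dots,a_{n_\gamma})$ are defined, $f_\gamma(xa_1,\dots,xa_{n_\gamma})$ is defined and equals $xf_\gamma(a_1,\dots,a_{n_\gamma})$ (for $n_\gamma=0$: if $xf_\gamma$ is defined, then $xf_\gamma=f_\gamma$). $\mathsf{pA}(G,\mathsf{pAl}(T))$ is the category of pairs $(\theta,\mathcal A)$ with $\theta$ a partial action of $G$ on a partial algebra $\mathcal A$ of type $T$; morphisms are maps that are both homomorphisms and morphisms of partial actions. $\mathsf A(G,\mathsf{pAl}(T))$ is the full subcategory of pairs with global $\theta$. Globalization. A globalization of $(\theta,\mathcal A)$ in $\mathsf A(G,\mathsf{pAl}(T))$ is $(\vartheta,\mathcal B)\in\mathsf A(G,\mathsf{pAl}(T))$ with an injective morphism $\iota:(\theta,\mathcal A)\to(\vartheta,\mathcal B)$ such that (1) $xa\neq\varnothing\iff x\iota(a)\in\iota(A)$ for all $x\in G$, $a\in A$; (2) if $f_\gamma(\iota(a_1),\dots,\iota(a_{n_\gamma}))$ is defined in $\mathcal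 B$ and equals $\iota(b)$ for some $b\in A$, then $f_\gamma(a_1,\dots,a_{n_\gamma})$ is defined in $\mathcal A$ and equals $b$. It is universal if for any globalization $\iota':(\theta,\mathcal A)\to(\vartheta',\mathcal B')$ in $\mathsf A(G,\mathsf{pAl}(T))$ there is a unique morphism $\kappa:(\vartheta,\mathcal B)\to(\vartheta',\mathcal B')$ with $\iota'=\kappa\circ\iota$. The construction $U$. $A^U=(G\times A)/{\sim}$, where $(x,a)\sim(y,b)$ iff $(y^{-1}x)a$ is defined and equals $b$; $[x,a]$ is the class of $(x,a)$; $\theta^U$ is the global action $x[y,a]=[xy,a]$. $\mathcal R(\mathcal A)^U$ is the relational system of type $T+1$ on $A^U$ whose $\gamma$-th relation is $\{([x,a_1],\dots,[x,a_{n_\gamma}],[x,f_\gamma(a_1,\dots,a_{n_\gamma})])\mid x\in G,\ f_\gamma(a_1,\dots,a_{n_\gamma})\text{ is defined}\}$. Reflector. For a subcategory $\mathsf D$ of $\mathsf C$, a $\mathsf D$-reflector of $C\in\mathsf C$ is an object $R\in\mathsf D$ with a morphism $\varepsilon:C\to R$ (here $\varepsilon(a)=[1,a]$) such that for every $D\in\mathsf D$ and every $\varphi:C\to D$ there is a unique $\psi:R\to D$ in $\mathsf D$ with $\psi\circ\varepsilon=\varphi$. Here $\mathsf C=\mathsf{pA}(G,\mathsf{pAl}(T))$. *)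

(* Defs.v *)
From mathcomp Require Import all_boot.
From mathcomp Require Import boolp classical_sets.

Set Implicit Arguments.
Unset Strict Implicit.
Unset Printing Implicit Defensive.

Local Open Scope group_scope.
Local Open Scope classical_set_scope.
Local Open Scope quotient_scope.

(* Partial maps are [option]-valued: [None] means "undefined". [groupType] is
   the structure of arbitrary, possibly infinite, groups; its choice operator
   is no restriction in the presence of the classical axioms of [boolp]. *)
Record paction (G : groupType) (A : Type) := PAction {
  pact :> G -> A -> option A;
  pact1 : forall a, pact 1 a = Some a;
  pactV : forall x a b, pact x a = Some b -> pact x^-1 b = Some a;
  pactM : forall x y a b c,
    pact y a = Some b -> pact x b = Some c -> pact (x * y) a = Some c }.

Definition global (G : groupType) (A : Type) (th : paction G A) : Prop :=
  forall x a, isSome (th x a).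

Definition paction_morphism (G : groupType) (A B : Type)
    (th : paction G A) (th' : paction G B) (phi : A -> B) : Prop :=
  forall x a b, th x a = Some b -> th' x (phi a) = Some (phi b).

(* A type of algebras {n_gamma}_{gamma < o(T)}. The order of the indices plays
   no role and any set can be well-ordered, so indices range over a type. *)
Record alg_type := AlgType { symb : Type; arity : symb -> nat }.
Arguments arity : clear implicits.

Definition alg_typeS (T : alg_type) : alg_type :=
  AlgType (fun g : symb T => (arity T g).+1).

Definition palg (T : alg_type) (A : Type) : Type :=
  forall g : symb T, (arity T g).-tuple A -> option A.

Definition palg_hom (T : alg_type) (A B : Type)
    (f : palg T A) (f' : palg T B) (phi : A -> B) : Prop :=
  forall (g : symb T) (a : (arity T g).-tuple A) (b : A),
    f g a = Some b -> f' g (map_tuple phi a) = Some (phi b).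

Definition relsys (T : alg_type) (A : Type) : Type :=
  forall g : symb T, set ((arity T g).-tuple A).

Definition relsys_of (T : alg_type) (A : Type) (f : palg T A) :
    relsys (alg_typeS T) A :=
  fun g : symb T => [set t | exists (a : (arity T g).-tuple A) (b : A),
                               f g a = Some b /\ t = rcons_tuple a b].

Definition functional_relsys (T : alg_type) (A : Type)
    (rho : relsys (alg_typeS T) A) : Prop :=
  forall (g : symb T) (a : (arity T g).-tuple A) (b c : A),
    rho g (rcons_tuple a b) -> rho g (rcons_tuple a c) -> b = c.

(* (th, f) is an object of pA(G, pAl(T)) with underlying set A. *)
Definition in_pA (G : groupType) (T : alg_type) (A : Type)
    (th : paction G A) (f : palg T A) : Prop :=
  forall (x : G) (g : symb T) (a xa : (arity T g).-tuple A) (b xb : A),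
    f g a = Some b ->
    (forall i, th x (tnth a i) = Some (tnth xa i)) ->
    th x b = Some xb ->
    f g xa = Some xb.

(* (th, f) is an object of A(G, pAl(T)) with underlying set A. *)
Definition in_A (G : groupType) (T : alg_type) (A : Type)
    (th : paction G A) (f : palg T A) : Prop :=
  in_pA th f /\ global th.

(* Morphisms of pA(G, pAl(T)), and of its full subcategory A(G, pAl(T)). *)
Definition morphism (G : groupType) (T : alg_type) (A B : Type)
    (th : paction G A) (f : palg T A) (th' : paction G B) (f' : palg T B)
    (phi : A -> B) : Prop :=
  palg_hom f f' phi /\ paction_morphism th th' phi.

Definition globalization (G : groupType) (T : alg_type) (A B : Type)
    (th : paction G A) (f : palg T A) (th' : paction G B) (f' : palg T B)
    (iota : A -> B) : Prop :=
  [/\ in_A th' f',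
      morphism th f th' f' iota,
      injective iota,
      (forall x a,
         isSome (th x a) <-> exists b, th' x (iota a) = Some (iota b))
    & (forall (g : symb T) (a : (arity T g).-tuple A) (b : A),
         f' g (map_tuple iota a) = Some (iota b) -> f g a = Some b)].

Definition has_globalization (G : groupType) (T : alg_type) (A : Type)
    (th : paction G A) (f : palg T A) : Prop :=
  exists (B : Type) (th' : paction G B) (f' : palg T B) (iota : A -> B),
    globalization th f th' f' iota.

Definition universal_globalization (G : groupType) (T : alg_type) (A B : Type)
    (th : paction G A) (f : palg T A) (th' : paction G B) (f' : palg T B)
    (iota : A -> B) : Prop :=
  globalization th f th' f' iota /\
  forall (C : Type) (th'' : paction G C) (f'' : palg T C) (iota' : A -> C),
    globalization th f th'' f'' iota' ->
    exists! kappa : B -> C,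
      morphism th' f' th'' f'' kappa /\ iota' = kappa \o iota.

(* (th', f') with eps : A -> R is an A(G, pAl(T))-reflector of (th, f). *)
Definition reflector (G : groupType) (T : alg_type) (A R : Type)
    (th : paction G A) (f : palg T A) (th' : paction G R) (f' : palg T R)
    (eps : A -> R) : Prop :=
  [/\ in_A th' f',
      morphism th f th' f' eps
    & forall (D : Type) (th'' : paction G D) (f'' : palg T D) (phi : A -> D),
        in_A th'' f'' -> morphism th f th'' f'' phi ->
        exists! psi : R -> D,
          morphism th' f' th'' f'' psi /\ psi \o eps = phi].

Section ConstructionU.
Variables (G : groupType) (A : Type) (th : paction G A).

(* [{classic A}] is A with its classical choice structure, which the library
   quotient requires. *)
Definition simU (p q : G * {classic A}) : bool :=
  `[< th (q.1^-1 * p.1) p.2 = Some q.2 >].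

Fact simU_equiv : equiv_class_of simU.
Proof.
have sym p q : simU p q -> simU q p.
  move=> /asboolP h; apply/asboolP.
  by have := pactV h; rewrite invgM invgK.
split=> [[x a]|p q|q p r].
- by apply/asboolP; rewrite mulVg pact1.
- by apply/idP/idP; apply: sym.
- move=> /asboolP h1 /asboolP h2; apply/asboolP.
  by have := pactM h1 h2; rewrite -mulgA mulVKg.
Qed.

Canonical simU_equiv_rel := EquivRelPack simU_equiv.

Definition AU : Type := {eq_quot simU_equiv_rel}.

Definition clsU (x : G) (a : A) : AU :=
  \pi_{eq_quot simU_equiv_rel} (x, a : {classic A}).

Lemma clsU_eq x a y b : clsU x a = clsU y b <-> th (y^-1 * x) a = Some b.
Proof.
rewrite /clsU; split=> [/eqmodP /asboolP //|h].
by apply/eqmodP/asboolP.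
Qed.

Definition actU_fun (x : G) (q : AU) : AU :=
  let p := repr (q : {eq_quot simU_equiv_rel}) in clsU (x * p.1) p.2.

Lemma actU_funE x y a : actU_fun x (clsU y a) = clsU (x * y) a.
Proof.
rewrite /actU_fun; case E: (repr _) => [z b] /=.
have /clsU_eq h : clsU z b = clsU y a by rewrite /clsU -E reprK.
by apply/clsU_eq; rewrite invgM -mulgA mulKg.
Qed.

Lemma clsU_surj (q : AU) : exists x a, q = clsU x a.
Proof.
exists (repr (q : {eq_quot simU_equiv_rel})).1.
exists (repr (q : {eq_quot simU_equiv_rel})).2.
by rewrite /clsU -surjective_pairing reprK.
Qed.

Fact actU1 q : Some (actU_fun 1 q) = Some q.
Proof. by have [x [a ->]] := clsU_surj q; rewrite actU_funE mul1g. Qed.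

Fact actUV x q r :
  Some (actU_fun x q) = Some r -> Some (actU_fun x^-1 r) = Some q.
Proof.
by have [y [a ->]] := clsU_surj q; move=> [<-]; rewrite !actU_funE mulKg.
Qed.

Fact actUM x y q r s : Some (actU_fun y q) = Some r ->
  Some (actU_fun x r) = Some s -> Some (actU_fun (x * y) q) = Some s.
Proof.
have [z [a ->]] := clsU_surj q.
by move=> [<-] [<-]; rewrite !actU_funE mulgA.
Qed.

Definition actU : paction G AU :=
  @PAction G AU (fun x q => Some (actU_fun x q)) actU1 actUV actUM.

Lemma actUE x y a : actU x (clsU y a) = Some (clsU (x * y) a).
Proof. by rewrite /= actU_funE. Qed.

Definition relsysU (T : alg_type) (rho : relsys T A) : relsys T AU :=
  fun g => [set t | exists (x : G) (s : (arity T g).-tuple A),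
                      rho g s /\ t = map_tuple (clsU x) s].

End ConstructionU.

Arguments relsysU {G A} th {T} rho.

(* Main.v *)
Require Import Defs.
From mathcomp Require Import all_boot.
From mathcomp Require Import boolp classical_sets.

(** Everything rests on one map. Let [phi] be a morphism from [(th, f)] to an
    object [(thC, fC)] with global action. Then [[x, a] |-> x (phi a)] is well
    defined on [A^U] ([extU]), is the only equivariant map extending [phi]
    along [a |-> [1, a]] ([extU_unique]), and sends each tuple of [R(A)^U] to a
    tuple of the graph of [fC] ([extU_rel]), because [fC] commutes with the
    total action.

    If [phi] is a globalization, the map is moreover injective ([extU_inj]):
    [x (phi a) = y (phi b)] says that [y^-1 x] moves [phi a] back into the
    image of [A], so that [(y^-1 x) a] is defined and equal to [b]. An
    injective map that sends [R(A)^U] into the graph of an operation forces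
    [R(A)^U] to be functional.

    Conversely, if [R(A)^U] is functional, it is the graph of a unique partial
    algebra [fU] ([relsys_of_functional], [relsys_of_inj]). The reflector
    property is then the existence and uniqueness of [extU]. The map
    [a |-> [1, a]] is a globalization because [[x, s] = [1, a]] means
    [x s = a]: an operation of [A^U] between elements of the image of [A] is
    the [x]-translate of an operation of [A], hence an operation of [A] by
    compatibility of [th] with [f]. Universality is a special case of the
    reflector property, since every globalization is a morphism to a global
    object. *)

Set Implicit Arguments.
Unset Strict Implicit.
Unset Printing Implicit Defensive.

Local Open Scope group_scope.
Local Open Scope classical_set_scope.
Local Open Scope quotient_scope.

(** * Graphs of partial operations *)

Lemma rcons_tuple_inj (n : nat) (X : Type) (a a' : n.-tuple X) (b b' : X) :
  rcons_tuple a b = rcons_tuple a' b' -> a = a' /\ b = b'.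
Proof.
move=> /(congr1 val) /= /rcons_inj [eq_a eq_b].
by split=> //; apply: val_inj.
Qed.

Lemma map_rcons_tuple (n : nat) (X Y : Type) (h : X -> Y) (a : n.-tuple X)
    (b : X) :
  map_tuple h (rcons_tuple a b) = rcons_tuple (map_tuple h a) (h b).
Proof. by apply: val_inj; rewrite /= map_rcons. Qed.

Section Graphs.
Variables (T : alg_type) (A : Type).

Lemma relsys_of_rcons (f : palg T A) (g : symb T) (a : (arity T g).-tuple A)
    (b : A) :
  @relsys_of T A f g (rcons_tuple a b) <-> f g a = Some b.
Proof.
split=> [[a' [b' [fab eq_t]]]|fab].
  by have [-> ->] := rcons_tuple_inj eq_t.
by exists a, b.
Qed.

Lemma relsys_of_inj : injective (@relsys_of T A).
Proof.
move=> f1 f2 eq_f; apply: functional_extensionality_dep => g.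
apply/funext => a.
have E b : f1 g a = Some b <-> f2 g a = Some b.
  by rewrite -!relsys_of_rcons eq_f.
case E1: (f1 g a) => [b|]; first by symmetry; apply/E.
by case E2: (f2 g a) => [b|] //; move/E: E2; rewrite E1.
Qed.

Lemma relsys_of_functional (rho : relsys (alg_typeS T) A) :
  functional_relsys rho -> exists f : palg T A, relsys_of f = rho.
Proof.
move=> rho_fun.
pose f : palg T A := fun g a =>
  if pselect (exists b, rho g (rcons_tuple a b)) is left ex_b
  then Some (projT1 (cid ex_b)) else None.
have fE g a b : f g a = Some b <-> rho g (rcons_tuple a b).
  rewrite /f; case: pselect => [ex_b|no_b]; last first.
    by split=> // rab; case: no_b; exists b.
  case: cid => c rac /=; split=> [[<-] //|rab].
  by rewrite (rho_fun _ _ _ _ rab rac).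
exists f; apply: functional_extensionality_dep => g; apply/seteqP; split=> t.
  by move=> [a [b [/fE rab ->]]].
(* every tuple of length n + 1 has the form [rcons_tuple a b] *)
case: t => s size_s; case/lastP: s size_s => [//|s b] size_sb rho_t.
have size_s : size s == arity T g by move: (size_sb); rewrite size_rcons eqSS.
have tE : Tuple size_sb = rcons_tuple (Tuple size_s) b by apply: val_inj.
by exists (Tuple size_s), b; rewrite -tE fE -tE.
Qed.

End Graphs.

Lemma relsysU_ofP (G : groupType) (T : alg_type) (A : Type)
    (th : paction G A) (f : palg T A) (g : symb T)
    (p : (arity T g).-tuple (AU th)) (q : AU th) :
  relsysU th (relsys_of f) (g : symb (alg_typeS T)) (rcons_tuple p q) <->
  exists x (a : (arity T g).-tuple A) b,
    [/\ f g a = Some b, p = map_tuple (clsU th x) a & q = clsU th x b].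
Proof.
split.
  move=> [x [_ [[a [b [fab ->]]] /= eq_pq]]]; exists x, a, b.
  by have [-> ->] := rcons_tuple_inj (etrans eq_pq (map_rcons_tuple _ _ _)).
move=> [x [a [b [fab -> ->]]]]; exists x, (rcons_tuple a b).
by rewrite map_rcons_tuple; split=> //; exists a, b.
Qed.

(** * Extending a morphism from A to its enveloping action *)

(** With a default value, a global action becomes an honest function even when
    the underlying set may be empty. *)
Definition total_act (G : groupType) (A : Type) (th : paction G A)
    (x : G) (a : A) : A := odflt a (th x a).

Section GlobalAction.
Variables (G : groupType) (C : Type) (thC : paction G C).
Hypothesis thC_global : global thC.

Lemma total_actE x c : thC x c = Some (total_act thC x c).
Proof. by rewrite /total_act; have := thC_global x c; case: (thC x c). Qed.

Lemma total_act1 c : total_act thC 1 c = c.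
Proof. by rewrite /total_act pact1. Qed.

Lemma total_actM x y c :
  total_act thC (x * y) c = total_act thC x (total_act thC y c).
Proof.
have := pactM (total_actE y c) (total_actE x _).
by rewrite total_actE => -[].
Qed.

Lemma total_act_inj x : injective (total_act thC x).
Proof.
by apply: (can_inj (g := total_act thC x^-1)) => c;
  rewrite -total_actM mulVg total_act1.
Qed.

Lemma total_act_palg (T : alg_type) (fC : palg T C) (x : G) (g : symb T)
    (a : (arity T g).-tuple C) (b : C) :
  in_pA thC fC -> fC g a = Some b ->
  fC g (map_tuple (total_act thC x) a) = Some (total_act thC x b).
Proof.
move=> HC fab; apply: (HC x g a _ b _ fab) (total_actE x b) => i.
by rewrite tnth_map total_actE.
Qed.

End GlobalAction.

Section Extension.
Variables (G : groupType) (T : alg_type) (A C : Type).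
Variables (th : paction G A) (f : palg T A).
Variables (thC : paction G C) (fC : palg T C) (phi : A -> C).
Hypothesis thC_global : global thC.

Definition extU (q : AU th) : C :=
  let p := repr (q : {eq_quot simU_equiv_rel th}) in
  total_act thC p.1 (phi p.2).

Lemma extU_cls x a :
  paction_morphism th thC phi -> extU (clsU th x a) = total_act thC x (phi a).
Proof.
move=> phi_act; rewrite /extU.
case E: (repr _) => [y b] /=.
have /clsU_eq/phi_act : clsU th x a = clsU th y b.
  by rewrite /clsU -E reprK.
rewrite (total_actE thC_global) => -[<-].
by rewrite -total_actM // mulVKg.
Qed.

Lemma extU_act :
  paction_morphism th thC phi -> paction_morphism (actU th) thC extU.
Proof.
move=> phi_act x q r; have [y [a ->]] := clsU_surj q.
rewrite actUE => -[<-].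
by rewrite !extU_cls // total_actM // -total_actE.
Qed.

Lemma extU_cls1 : paction_morphism th thC phi -> extU \o clsU th 1 = phi.
Proof.
by move=> phi_act; apply/funext => a /=; rewrite extU_cls // total_act1.
Qed.

(** The classes [[1, a]] generate [A^U] under the action, since
    [[x, a] = x [1, a]]. *)
Lemma extU_unique (psi : AU th -> C) :
  paction_morphism th thC phi -> paction_morphism (actU th) thC psi ->
  psi \o clsU th 1 = phi -> psi = extU.
Proof.
move=> phi_act psi_act psi1; apply/funext => q.
have [x [a ->]] := clsU_surj q.
have := psi_act _ _ _ (actUE th x 1 a).
have -> : psi (clsU th 1 a) = phi a by rewrite -psi1.
by rewrite mulg1 (total_actE thC_global) extU_cls // => -[].
Qed.

(** A tuple of [R(A)^U] is the [x]-translate of a tuple of the graph of [f];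
    [phi] carries the latter into the graph of [fC], which is stable under
    translation. *)
Lemma extU_rel (g : symb T) (p : (arity T g).-tuple (AU th)) (q : AU th) :
  in_pA thC fC -> morphism th f thC fC phi ->
  relsysU th (relsys_of f) (g : symb (alg_typeS T)) (rcons_tuple p q) ->
  @fC g (map_tuple extU p) = Some (extU q).
Proof.
move=> HC [phi_hom phi_act] /relsysU_ofP [x [a [b [/phi_hom fab -> ->]]]].
have -> : map_tuple extU (map_tuple (clsU th x) a)
        = map_tuple (total_act thC x) (map_tuple phi a).
  apply: eq_from_tnth => i.
  by rewrite !tnth_map extU_cls.
by rewrite extU_cls //; apply: total_act_palg.
Qed.

(** Condition (1) of a globalization is what makes this work: [x (phi a) =
    y (phi b)] puts [y^-1 x (phi a)] in the image of [phi], so [(y^-1 x) a] is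
    already defined in [A]. *)
Lemma extU_inj : globalization th f thC fC phi -> injective extU.
Proof.
move=> [_ [_ phi_act] phi_inj phi_dom _] q r.
have [x [a ->]] := clsU_surj q; have [y [b ->]] := clsU_surj r.
rewrite !extU_cls // => eq_xy; apply/clsU_eq.
have yx_a : thC (y^-1 * x) (phi a) = Some (phi b).
  rewrite total_actE //; congr Some; apply: (total_act_inj thC_global (x := y)).
  by rewrite -total_actM // mulVKg.
have : isSome (th (y^-1 * x) a) by apply/phi_dom; exists b.
case E: (th _ a) => [c|] // _.
by have := phi_act _ _ _ E; rewrite yx_a => -[/phi_inj ->].
Qed.

End Extension.

(** [extU] embeds [R(A)^U] into the graph of the operations of the
    globalization, and the latter is functional. *)
Lemma globalization_functional (G : groupType) (T : alg_type) (A : Type)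
    (th : paction G A) (f : palg T A) :
  has_globalization th f -> functional_relsys (relsysU th (relsys_of f)).
Proof.
move=> [C [thC [fC [iota glob]]]] g p q r rel_q rel_r.
have [[HC gC] iota_mor _ _ _] := glob.
apply: (extU_inj gC glob).
have := extU_rel gC HC iota_mor rel_r.
by rewrite (extU_rel gC HC iota_mor rel_q) => -[].
Qed.

(** * The partial algebra on the enveloping action *)

Section AlgebraU.
Variables (G : groupType) (T : alg_type) (A : Type).
Variables (th : paction G A) (f : palg T A) (fU : palg T (AU th)).
Hypothesis fU_rel : relsys_of fU = relsysU th (relsys_of f).

Lemma palgUP (g : symb T) (p : (arity T g).-tuple (AU th)) (q : AU th) :
  @fU g p = Some q <->
  exists x (a : (arity T g).-tuple A) b,
    [/\ @f g a = Some b, p = map_tuple (clsU th x) a & q = clsU th x b].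
Proof. by rewrite -relsys_of_rcons fU_rel relsysU_ofP. Qed.

Lemma palgU_cls (g : symb T) x (a : (arity T g).-tuple A) b :
  @f g a = Some b -> @fU g (map_tuple (clsU th x) a) = Some (clsU th x b).
Proof. by move=> fab; apply/palgUP; exists x, a, b. Qed.

Lemma palgU_in_A : in_A (actU th) fU.
Proof.
split=> // x g p xp q xq /palgUP [y [a [b [fab -> ->]]]] eq_xp.
rewrite actUE => -[<-].
have -> : xp = map_tuple (clsU th (x * y)) a.
  apply: eq_from_tnth => i; have := eq_xp i.
  by rewrite !tnth_map actUE => -[].
exact: palgU_cls.
Qed.

Lemma clsU1_morphism : morphism th f (actU th) fU (clsU th 1).
Proof.
split=> [g a b|x a b xa]; first exact: palgU_cls.
by rewrite actUE; congr Some; apply/clsU_eq; rewrite invg1 mul1g mulg1.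
Qed.

Lemma clsU1_globalization :
  in_pA th f -> globalization th f (actU th) fU (clsU th 1).
Proof.
move=> Hf; split; [exact: palgU_in_A|exact: clsU1_morphism|..].
- by move=> a b /clsU_eq; rewrite mulVg pact1 => -[].
- move=> x a; split=> [|[b]].
    case E: (th x a) => [b|] // _; exists b.
    exact: (proj2 clsU1_morphism).
  by rewrite actUE mulg1 => -[/clsU_eq]; rewrite invg1 mul1g => ->.
move=> g a b /palgUP [x [s [c [fsc eq_a /esym/clsU_eq]]]].
rewrite invg1 mul1g => xc.
(* [f s = c] while [x s_i = a_i] and [x c = b], so compatibility of [th] with
   [f] gives [f a = b] *)
apply: (Hf x g s a c b fsc) xc => i.
have /clsU_eq : clsU th x (tnth s i) = clsU th 1 (tnth a i).
  by have := congr1 (fun t => tnth t i) eq_a; rewrite !tnth_map.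
by rewrite invg1 mul1g.
Qed.

Lemma clsU1_reflector : reflector th f (actU th) fU (clsU th 1).
Proof.
split; [exact: palgU_in_A|exact: clsU1_morphism|].
move=> C thC fC phi [HC gC] phi_mor; have [_ phi_act] := phi_mor.
exists (extU thC phi); split; last first.
  by move=> psi [[_ psi_act] psi1]; rewrite -(extU_unique gC phi_act psi_act psi1).
split; last exact: extU_cls1.
split; last exact: extU_act.
move=> g p q fpq; apply: (extU_rel gC HC phi_mor).
by rewrite -fU_rel relsys_of_rcons.
Qed.

End AlgebraU.

Lemma reflector_universal (G : groupType) (T : alg_type) (A B : Type)
    (th : paction G A) (f : palg T A) (thB : paction G B) (fB : palg T B)
    (iota : A -> B) :
  globalization th f thB fB iota -> reflector th f thB fB iota ->
  universal_globalization th f thB fB iota.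
Proof.
move=> glob [_ _ refl]; split=> // C thC fC phi [HC phi_mor _ _ _].
have [psi [[psi_mor psi1] psi_uniq]] := refl _ _ _ _ HC phi_mor.
exists psi; split=> // kappa [kappa_mor kappa1].
exact: psi_uniq.
Qed.

Theorem theorem3p3 (G : groupType) (T : alg_type) (A : Type)
    (th : paction G A) (f : palg T A) (Hthf : in_pA th f) :
  (has_globalization th f <-> functional_relsys (relsysU th (relsys_of f))) /\
  (functional_relsys (relsysU th (relsys_of f)) ->
   exists fU : palg T (AU th),
     [/\ unique (fun h : palg T (AU th) =>
                   relsys_of h = relsysU th (relsys_of f)) fU,
         (forall (g : symb T) (x : G) (a : (arity T g).-tuple A) (b : A),
            f g a = Some b ->
            fU g (map_tuple (clsU th x) a) = Some (clsU th x b)),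
         universal_globalization th f (actU th) fU (clsU th 1%g)
       & reflector th f (actU th) fU (clsU th 1%g)]).
Proof.
split.
  split=> [|/relsys_of_functional [fU fU_rel]].
    exact: globalization_functional.
  by exists (AU th), (actU th), fU, (clsU th 1); apply: clsU1_globalization.
move=> /relsys_of_functional [fU fU_rel]; exists fU; split.
- by split=> // h h_rel; apply: relsys_of_inj; rewrite fU_rel h_rel.
- by move=> g x a b; apply: palgU_cls.
- apply: reflector_universal; first exact: clsU1_globalization.
  exact: clsU1_reflector.
- exact: clsU1_reflector.
Qed.
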